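(* Let $\bar R=[R_1,R_2]^2$ be a fixed, sufficiently large square, and let $R=[s_1,s_2]\times[t_1,t_2]\subset\bar R$ with $s_1<s_2$, $t_1<t_2$. Assume that $x\in\mathcal C^{\gamma,\hat\gamma}$ and $y\in\mathcal C^{\rho,\hat\rho}$, with $\gamma,\hat\gamma,\rho,\hat\rho\in(0,1)$, $\gamma+\rho>1$ and $\hat\gamma+\hat\rho>1$, and that there exist two positive constants $K,K'$ such that $$|y(s,t)-y(s',t)|\le K|s-s'|^{\alpha},\qquad s,s'\in[s_1,s_2],\ t\in[t_1,t_2],$$ $$|y(s,t)-y(s,t')|\le K'|t-t'|^{\beta},\qquad s\in[s_1,s_2],\ t,t'\in[t_1,t_2],$$ with $\alpha>1-\gamma$ and $\beta>1-\hat\gamma$. Let $(\Pi^\delta)_{\delta>0}$ be a family of partitions of $R$ into rectangles with sides parallel to the axes, $\Pi^\delta=((s_i^\delta,t_j^\delta))_{i,j}$ with $s_1=s_0^\delta\le\dots\le s_{k^\delta}^\delta=s_2$ and $t_1=t_0^\delta\le\dots\le t_{\bar k^\delta}^\delta=t_2$, whose meshes go to zero as $\delta$ decreases to zero. Then the Riemann sums $$z_R^{\Pi^\delta}=\sum_{i=0}^{k^\delta-1}\sum_{j=0}^{\bar k^\delta-1}y(s_i^\delta,t_j^\delta)\,\Delta_{[s_i^\delta,s_{i+1}^\delta]\times[t_j^\delta,t_{j+1}^\delta]}x$$ converge, as $\delta$ decreases to zero, to some limit denoted by $z_R=\iint_Ry(s,t)\,x(ds,dt)$. Furthermore, considering $z$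 as a function of $s_1,s_2,t_1,t_2$, one has $$\left|\iint_Ry(s,t)\,x(ds,dt)\right|\le C\,(\|y\|_\infty+\|y\|)\,\|x\|_{\gamma,\hat\gamma}\,(s_2-s_1)^\gamma(t_2-t_1)^{\hat\gamma}$$ for a positive constant $C$, and in particular $z$ defines a continuous function $$\bar R\times\bar R\to\mathbb R,\qquad ((s_1,t_1),(s_2,t_2))\mapsto z_R.$$
   Context: For a rectangle $Q=[s,s']\times[t,t']$ and a function $g$ on $Q$, the rectangular increment is $\Delta_Qg=g(s,t)-g(s,t')-g(s',t)+g(s',t')$. For $a,b\in(0,1)$, $\mathcal C^{a,b}$ is the set of continuous functions $f$ on $\bar R$ with $$\|f\|_{a,b}=\sup_{s<s',\,t<t'}\frac{|\Delta_{[s,s']\times[t,t']}f|}{|s'-s|^a\,|t'-t|^b}<\infty.$$ The semi-norm of $y$ is $\|y\|=\|y\|_{\rho,\hat\rho}+\|y\|_{1:\alpha}+\|y\|_{2:\beta}$, where $\|y\|_{1:\alpha}$ and $\|y\|_{2:\beta}$ denote the Hölder norms of $y$ of exponent $\alpha$ with respect to the first variable and $\beta$ with respect to the second variable, uniformly in the other variable. $\|y\|_\infty$ is the supremum norm. *)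

(* Defs.v *)
From mathcomp Require Import all_boot all_order all_algebra.
From mathcomp Require Import all_classical all_reals all_analysis.
Import Order.TTheory GRing.Theory Num.Theory.
Import numFieldNormedType.Exports.

Set Implicit Arguments.
Unset Strict Implicit.
Unset Printing Implicit Defensive.

Local Open Scope classical_set_scope.
Local Open Scope ring_scope.

Section Defs.
Context {R : realType}.

Definition rect (s s' t t' : R) : set (R * R) := `[s, s'] `*` `[t, t'].

Definition rect_incr (f : R * R -> R) (s s' t t' : R) : R :=
  f (s, t) - f (s, t') - f (s', t) + f (s', t').

(* Functions on a domain D are total functions of which only the values on D
   matter; all norms take values in \bar R, so an infinite norm is +oo. *)
Definition rect_norm (D : set (R * R)) (a b : R) (f : R * R -> R) : \bar R :=
  ereal_sup [set r | exists s s' t t' : R,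
    [/\ s < s', t < t', rect s s' t t' `<=` D &
      r = (`|rect_incr f s s' t t'|
             / (`|s' - s| `^ a * `|t' - t| `^ b))%:E]].

Definition rect_holder (D : set (R * R)) (a b : R) : set (R * R -> R) :=
  [set f | {within D, continuous f} /\ (rect_norm D a b f < +oo)%E].

Definition holder_norm1 (D : set (R * R)) (a : R) (f : R * R -> R) : \bar R :=
  ereal_sup [set r | exists s s' t : R,
    [/\ s != s', D (s, t), D (s', t) &
      r = (`|f (s, t) - f (s', t)| / `|s - s'| `^ a)%:E]].

Definition holder_norm2 (D : set (R * R)) (b : R) (f : R * R -> R) : \bar R :=
  ereal_sup [set r | exists s t t' : R,
    [/\ t != t', D (s, t), D (s, t') &
      r = (`|f (s, t) - f (s, t')| / `|t - t'| `^ b)%:E]].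

Definition sup_norm (D : set (R * R)) (f : R * R -> R) : \bar R :=
  ereal_sup [set `|f p|%:E | p in D].

Definition holder_cond (s1 s2 t1 t2 alpha beta : R) (y : R * R -> R) : Prop :=
  exists K K' : R, [/\ 0 < K, 0 < K',
    forall s s' t, s \in `[s1, s2] -> s' \in `[s1, s2] -> t \in `[t1, t2] ->
      `|y (s, t) - y (s', t)| <= K * `|s - s'| `^ alpha &
    forall s t t', s \in `[s1, s2] -> t \in `[t1, t2] -> t' \in `[t1, t2] ->
      `|y (s, t) - y (s, t')| <= K' * `|t - t'| `^ beta].

(* a = u 0 <= u 1 <= ... <= u n = b; repeated points are allowed *)
Definition subdivision (a b : R) (n : nat) (u : nat -> R) : Prop :=
  [/\ u 0%N = a, u n = b & forall i, (i < n)%N -> u i <= u i.+1].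

Definition mesh (n : nat) (u : nat -> R) : R :=
  \big[Num.max/0]_(i < n) (u i.+1 - u i).

(* The values of the family at parameters delta <= 0 are irrelevant. *)
Definition partition_family (a b : R) (k : R -> nat) (u : R -> nat -> R) :=
  (forall delta : R, 0 < delta -> subdivision a b (k delta) (u delta)) /\
  mesh (k delta) (u delta) @[delta --> 0^'+] --> (0 : R).

Definition riemann_sum (y x : R * R -> R)
    (k k' : nat) (u v : nat -> R) : R :=
  \sum_(i < k) \sum_(j < k')
    y (u i, v j) * rect_incr x (u i) (u i.+1) (v j) (v j.+1).

(* The same z is the limit along every family of grid partitions. *)
Definition riemann_sums_cvg (y x : R * R -> R) (s1 s2 t1 t2 z : R) : Prop :=
  forall (k k' : R -> nat) (u v : R -> nat -> R),
    partition_family s1 s2 k u -> partition_family t1 t2 k' v ->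
    riemann_sum y x (k delta) (k' delta) (u delta) (v delta)
      @[delta --> 0^'+] --> z.

(* The (unique) limit of the Riemann sums if they converge. *)
Definition rect_integral (y x : R * R -> R) (s1 s2 t1 t2 : R) : R :=
  get [set z | riemann_sums_cvg y x s1 s2 t1 t2 z].

(* Extension to arbitrary pairs of points by the usual orientation convention:
   zero if the rectangle is degenerate, and a change of sign whenever the
   endpoints are exchanged in one of the variables. *)
Definition oriented_integral (y x : R * R -> R) (p q : R * R) : R :=
  Num.sg (q.1 - p.1) * Num.sg (q.2 - p.2) *
  rect_integral y x (Num.min p.1 q.1) (Num.max p.1 q.1)
                    (Num.min p.2 q.2) (Num.max p.2 q.2).

End Defs.

(* Main.v *)
Require Import Defs.
From mathcomp Require Import all_boot all_order all_algebra.
From mathcomp Require Import all_classical all_reals all_analysis.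
From mathcomp Require Import ring lra zify.
Import Order.TTheory GRing.Theory Num.Theory.
Import numFieldNormedType.Exports.

(** Freeze the subdivision [v] of the second variable.  The Riemann sum is then
    a sum, over the steps of a subdivision [u] of the first variable, of the
    germ
      A (s, s') = sum_j y (s, v_j) * incr x (s, s'; v_j, v_{j+1}),
    and the defect of additivity A (s, s') - A (s, r) - A (r, s') is a
    one-dimensional Riemann sum of [y (s, .) - y (r, .)] against
    [x (s', .) - x (r, .)].  By Young's estimate ([young_sum]) this defect is
    at most a combination of |s' - s| ^ (alpha + gamma) and
    |s' - s| ^ (rho + gamma), with coefficients that do not depend on [v]:
    the increments of the integrand are controlled by the rectangular Hoelder
    norm of [y], and its initial value by the Hoelder norm of [y] in the first
    variable ([row_defect]).  Both powers exceed one, so that sewing applies: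
    refining [u] changes the sum by at most sum_i phi (u_{i+1} - u_i), where
    phi (h) = o (h) is a gauge that is independent of [v]
    ([riemann_sum_refine]).  Exchanging the two variables gives the same for
    refinements of [v].

    Two grids are now compared through a common refinement
    ([riemann_sum_dist]): their Riemann sums S, S' satisfy
    |S - S'| <= err + err', each error depending on one grid only.  Hence the
    supremum z of all S - err satisfies |S - z| <= err for every grid
    ([riemann_limit_exists]), and err tends to zero with the meshes, so z is
    the limit along all families.  For the grid with a single rectangle the
    same inequality is the bound on the integral ([rect_integral_bound]).

    For the continuity in the corners, concatenation of subdivisions shows
    that the integral is additive in each variable, so that the oriented
    integral is the rectangular increment of the function
    F (s, t) = integral over [R1, s] x [R1, t] ([oriented_integral_area]).
    The differences of F are integrals over thin rectangles, and the bound
    makes F Hoelder continuous ([area_modulus]). *)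

Set Implicit Arguments.
Unset Strict Implicit.
Unset Printing Implicit Defensive.

Local Open Scope classical_set_scope.
Local Open Scope ring_scope.

(** * Sewing of almost additive germs *)

Section Sewing.
Context {R : realType}.
Implicit Types (phi psi : R -> R) (kappa h e a b : R).

(** The functions that may bound a defect of additivity in the sewing lemma.
    For [kappa < 1] the third condition makes the sum of the values of [phi]
    over two halves of an interval smaller than its value on the whole by a
    fixed factor; this replaces a power [h `^ p] with [1 < p], and has the
    advantage of being stable under sums.  The last condition, phi (h) = o (h),
    makes the total error of a fine subdivision small. *)
Definition gauge (kappa : R) (phi : R -> R) : Prop :=
  [/\ phi 0 = 0,
      forall h k, 0 <= h -> h <= k -> phi h <= phi k,
      forall h, 0 <= h -> 2 * phi (h / 2) <= kappa * phi h &
      forall e, 0 < e -> exists2 d, 0 < d &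
        forall h, 0 <= h -> h <= d -> phi h <= e * h].

Lemma gauge_ge0 kappa phi h : gauge kappa phi -> 0 <= h -> 0 <= phi h.
Proof. by move=> [phi0 phimono _ _] h0; rewrite -phi0; exact: phimono. Qed.

Lemma gaugeD kappa phi psi : gauge kappa phi -> gauge kappa psi ->
  gauge kappa (fun h => phi h + psi h).
Proof.
move=> [f0 fm fh fs] [g0 gm gh gs]; split.
- by rewrite f0 g0 addr0.
- by move=> h k h0 hk; rewrite lerD ?fm ?gm.
- by move=> h h0; rewrite !mulrDr lerD ?fh ?gh.
- move=> e e0; have e20 : 0 < e / 2 by rewrite divr_gt0.
  have [d d0 Hd] := fs _ e20; have [d' d'0 Hd'] := gs _ e20.
  exists (Num.min d d'); first by rewrite lt_min d0.
  move=> h h0; rewrite le_min => /andP[hd hd'].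
  by rewrite [e]splitr mulrDl lerD ?Hd ?Hd'.
Qed.

Lemma gaugeZ kappa c phi : 0 <= c -> gauge kappa phi ->
  gauge kappa (fun h => c * phi h).
Proof.
move=> c0 [f0 fm fh fs]; split.
- by rewrite f0 mulr0.
- by move=> h k h0 hk; rewrite ler_wpM2l// fm.
- by move=> h h0; rewrite mulrCA [leRHS]mulrCA ler_wpM2l// fh.
- move=> e e0; have c1 : 0 < c + 1 by rewrite ltr_wpDl.
  have [d d0 Hd] := fs (e / (c + 1)) (divr_gt0 e0 c1); exists d => // h h0 hd.
  apply: (@le_trans _ _ (c * (e / (c + 1) * h))).
    by rewrite ler_wpM2l// Hd.
  rewrite mulrA ler_wpM2r// mulrCA -[leRHS]mulr1 ler_wpM2l//; first exact: ltW.
  by rewrite ler_pdivrMr// mul1r lerDl.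
Qed.

Lemma gauge_powR theta p : 1 < theta -> theta <= p ->
  gauge (2 `^ (1 - theta)) (fun h : R => h `^ p).
Proof.
move=> t1 tp; have p1 : 1 < p by exact: lt_le_trans tp.
have p0 : 0 < p by exact: lt_trans p1.
split.
- by rewrite powR0 ?gt_eqF.
- move=> h k h0 hk; have k0 := le_trans h0 hk.
  by rewrite ge0_ler_powR ?nnegrE// ltW.
- move=> h h0; rewrite powRM ?invr_ge0//.
  rewrite mulrCA [leRHS]mulrC ler_wpM2l ?powR_ge0//.
  rewrite -powR_inv1// -powRrM mulN1r -[X in X * _](@powRr1 _ 2)//.
  rewrite -powRD; last by rewrite (_ : 2 != 0) ?implybT// pnatr_eq0.
  by rewrite ler_powR ?ler1n// lerD2l lerN2.
- move=> e e0; have q0 : 0 < p - 1 by rewrite subr_gt0.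
  exists (e `^ (p - 1)^-1); first exact: powR_gt0.
  move=> h h0 hd; rewrite -mulr_powRB1// mulrC ler_wpM2r//.
  have -> : e = (e `^ (p - 1)^-1) `^ (p - 1).
    by rewrite -powRrM mulVf ?gt_eqF// powRr1// ltW.
  by rewrite ge0_ler_powR ?nnegrE ?powR_ge0// ltW.
Qed.

Lemma subdivision_le m n (u : nat -> R) :
  (forall i, (m <= i < n)%N -> u i <= u i.+1) ->
  forall i j, (m <= i)%N -> (i <= j)%N -> (j <= n)%N -> u i <= u j.
Proof.
move=> Hu i j mi; elim: j => [|j IH].
  by rewrite leqn0 => /eqP ->.
rewrite leq_eqVlt => /orP[/eqP ->//|]; rewrite ltnS => ij jn.
apply: (le_trans (IH ij (ltnW jn))); apply: Hu.
by rewrite (leq_trans mi ij).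
Qed.

Lemma subdivision_endpoints a b n (u : nat -> R) :
  subdivision a b n u -> a <= b.
Proof. by move=> [<- <- Hu]; exact: (@subdivision_le 0 n u). Qed.

(** A subdivision can be cut into two parts that both have at most half of
    the total length, by leaving out the single step that straddles the
    midpoint. *)
Lemma halving m n (u : nat -> R) : (m < n)%N ->
  (forall i, (m <= i < n)%N -> u i <= u i.+1) ->
  exists k, [/\ (m <= k < n)%N, u k - u m <= (u n - u m) / 2 &
                u n - u k.+1 <= (u n - u m) / 2].
Proof.
move=> mn Hu.
have le_u := subdivision_le Hu.
have umn : u m <= u n by apply: le_u => //; exact: ltnW.
pose P k := (m <= k < n)%N && (u k - u m <= (u n - u m) / 2).
have exP : exists k, P k.
  by exists m; rewrite /P leqnn mn /= subrr; lra.
have ubP k : P k -> (k <= n)%N by move=> /andP[/andP[_ /ltnW]].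
case: (ex_maxnP exP ubP) => k /andP[/andP[mk kn] Pk] maxk.
(* k is the last index, other than n, whose point lies left of the midpoint. *)
exists k; split => //; first by rewrite mk.
case: (eqVneq k.+1 n) => [->|kn1]; first by lra.
have kn2 : (k.+1 < n)%N by rewrite ltn_neqAle kn1.
have : ~~ P k.+1 by apply/negP => /maxk; rewrite ltnn.
rewrite /P kn2 (leq_trans mk (leqnSn k)) /= -ltNge; lra.
Qed.

(** This is the fixed point of c = kappa * c + 2: cutting a subdivision by
    [halving] costs two defects, and the two parts together contribute at most
    kappa times the bound. *)
Definition sewing_const (kappa : R) : R := 2 / (1 - kappa).

(** Strong induction on the number of steps: cut by [halving] into two parts
    and one step.  Replacing the germ of the whole interval by the germs of
    these three pieces costs two defects, and the gauge condition lets the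
    bounds of the two parts be absorbed.  The bound does not depend on the
    number of steps. *)
Lemma sewing kappa phi (A : R -> R -> R) a b :
  kappa < 1 -> gauge kappa phi ->
  (forall s r t, a <= s -> s <= r -> r <= t -> t <= b ->
     `|A s t - A s r - A r t| <= phi (t - s)) ->
  forall (u : nat -> R) m n, (m <= n)%N -> a <= u m -> u n <= b ->
  (forall i, (m <= i < n)%N -> u i <= u i.+1) ->
  `|\sum_(m <= i < n) A (u i) (u i.+1) - A (u m) (u n)|
     <= sewing_const kappa * phi (u n - u m).
Proof.
move=> k1 gphi HA u m n; have [f0 fm fh _] := gphi.
have k1' : 0 < 1 - kappa by rewrite subr_gt0.
have c0 : 0 <= sewing_const kappa by rewrite divr_ge0// ltW.
have [l] := ubnP (n - m)%N; elim: l m n => // l IH m n.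
rewrite ltnS leq_eqVlt => lmn.
rewrite leq_eqVlt => /orP[/eqP -> aum umb _|mn aum unb Hu].
  rewrite big_geq// subrr f0 mulr0 sub0r normrN.
  by have := HA (u n) (u n) (u n) aum (lexx _) (lexx _) umb;
    rewrite !subrr sub0r normrN f0.
have [k [/andP[mk kn] hl hr]] := halving mn Hu.
have le_u := subdivision_le Hu.
have umk : u m <= u k by rewrite le_u// ltnW.
have ukk : u k <= u k.+1 by rewrite Hu// mk.
have ukn : u k.+1 <= u n by rewrite le_u// (leq_trans mk).
have El := IH m k; have Er := IH k.+1 n.
rewrite (@big_cat_nat _ _ _ k)//=; last exact: ltnW.
rewrite (@big_ltn _ _ _ k)//.
set Sl := \sum_(m <= i < k) _ in El *; set Sr := \sum_(k.+1 <= i < n) _ in Er *.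
have {}El : `|Sl - A (u m) (u k)| <= sewing_const kappa * phi ((u n - u m) / 2).
  apply: (le_trans (El _ _ aum _ _)) => //.
  - by move: lmn mn; clear -mk kn; move=> /orP[]; lia.
  - by rewrite (le_trans (le_trans ukk ukn)).
  - by move=> i /andP[mi ik]; rewrite Hu// mi (ltn_trans ik).
  - by rewrite ler_wpM2l// fm// subr_ge0.
have {}Er : `|Sr - A (u k.+1) (u n)| <=
    sewing_const kappa * phi ((u n - u m) / 2).
  apply: (le_trans (Er _ kn _ unb _)) => //.
  - by move: lmn mn; clear -mk kn; move=> /orP[]; lia.
  - by rewrite (le_trans aum)// (le_trans umk).
  - by move=> i /andP[ki ik]; rewrite Hu// ik (leq_trans mk)// ltnW.
  - by rewrite ler_wpM2l// fm// subr_ge0.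
have D1 := HA (u m) (u k) (u n) aum umk (le_trans ukk ukn) unb.
have D2 := HA (u k) (u k.+1) (u n) (le_trans aum umk) ukk ukn unb.
have D2' : phi (u n - u k) <= phi (u n - u m).
  by apply: fm; [rewrite subr_ge0 (le_trans ukk)|rewrite lerD2l lerN2].
have H2 := fh (u n - u m) _.
have umn : 0 <= u n - u m by rewrite subr_ge0 (le_trans umk)// (le_trans ukk).
have {}H2 := H2 umn.
have -> : Sl + (A (u k) (u k.+1) + Sr) - A (u m) (u n) =
  (Sl - A (u m) (u k)) + (Sr - A (u k.+1) (u n)) -
  (A (u m) (u n) - A (u m) (u k) - A (u k) (u n)) -
  (A (u k) (u n) - A (u k) (u k.+1) - A (u k.+1) (u n)) by ring.
set c := sewing_const kappa in El Er c0 *.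
have Hc : c = c * kappa + 2.
  by rewrite /c /sewing_const; field; rewrite gt_eqF.
apply: (@le_trans _ _ (c * phi ((u n - u m) / 2) + c * phi ((u n - u m) / 2)
   + phi (u n - u m) + phi (u n - u m))).
  apply: (le_trans (ler_normB _ _)); rewrite lerD ?(le_trans D2)//.
  apply: (le_trans (ler_normB _ _)); rewrite lerD//.
  by apply: (le_trans (ler_normD _ _)); rewrite lerD.
have {}H2 := ler_wpM2l c0 H2.
have -> : c * phi (u n - u m) =
    c * (kappa * phi (u n - u m)) + 2 * phi (u n - u m).
  by rewrite {1}Hc; ring.
lra.
Qed.

(** A refinement [w] of a subdivision is described by the indices [sigma i]
    that the coarse points have in [w]; [sewing] is applied between
    consecutive coarse points. *)
Lemma sewing_refine kappa phi (A : R -> R -> R) a b :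
  kappa < 1 -> gauge kappa phi ->
  (forall s r t, a <= s -> s <= r -> r <= t -> t <= b ->
     `|A s t - A s r - A r t| <= phi (t - s)) ->
  forall (w : nat -> R) N (sigma : nat -> nat) n, subdivision a b N w ->
  sigma 0%N = 0%N -> sigma n = N ->
  (forall i, (i < n)%N -> (sigma i <= sigma i.+1)%N) ->
  `|\sum_(i < N) A (w i) (w i.+1)
    - \sum_(i < n) A (w (sigma i)) (w (sigma i.+1))|
     <= \sum_(i < n) sewing_const kappa * phi (w (sigma i.+1) - w (sigma i)).
Proof.
move=> k1 gphi HA w N sigma n [w0 wN wm] s0 sn sm.
have le_w : forall i j, (i <= j)%N -> (j <= N)%N -> w i <= w j.
  by move=> i j; apply: (@subdivision_le 0 N w).
have le_s : forall i j, (i <= j)%N -> (j <= n)%N -> (sigma i <= sigma j)%N.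
  move=> i; elim=> [|j IH]; first by rewrite leqn0 => /eqP ->.
  rewrite leq_eqVlt => /orP[/eqP ->//|]; rewrite ltnS => ij jn.
  by rewrite (leq_trans (IH ij (ltnW jn)))// sm.
have split k : (k <= n)%N -> \sum_(0 <= i < sigma k) A (w i) (w i.+1) =
  \sum_(i < k) \sum_(sigma i <= j < sigma i.+1) A (w j) (w j.+1).
  elim: k => [_|k IH kn]; first by rewrite s0 big_geq// big_ord0.
  rewrite big_ord_recr /= -IH ?(ltnW kn)// -big_cat_nat//.
  by rewrite sm.
rewrite -(big_mkord xpredT (fun i => A (w i) (w i.+1))) -sn split// -sumrB.
apply: (le_trans (ler_norm_sum _ _ _)); apply: ler_sum => i _.
apply: (sewing k1 gphi HA) => //.
- exact: sm.
- by rewrite -w0 le_w// -sn le_s// ltnW.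
- by rewrite -wN le_w// -sn le_s.
- move=> j /andP[_ jN]; apply: wm; apply: (leq_trans jN).
  by rewrite -sn le_s.
Qed.

(** The points of both subdivisions, sorted; a point is located by its first
    occurrence, so that equal points get equal indices.  Repetitions of the
    endpoint [b] may remain at the end of the sorted list, which is why the
    refinement stops at the first occurrence of [b]. *)
Lemma common_refinement a b n (u : nat -> R) m (v : nat -> R) :
  subdivision a b n u -> subdivision a b m v ->
  exists N (w : nat -> R) (sigma tau : nat -> nat),
  [/\ subdivision a b N w,
      [/\ sigma 0%N = 0%N, sigma n = N,
        forall i, (i < n)%N -> (sigma i <= sigma i.+1)%N &
        forall i, (i <= n)%N -> w (sigma i) = u i] &
      [/\ tau 0%N = 0%N, tau m = N,
        forall i, (i < m)%N -> (tau i <= tau i.+1)%N &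
        forall i, (i <= m)%N -> w (tau i) = v i]].
Proof.
move=> [u0 un um] [v0 vm vmm].
pose s := map u (iota 0 n.+1) ++ map v (iota 0 m.+1).
pose t := sort <=%R s.
have le_u : forall i j, (i <= j)%N -> (j <= n)%N -> u i <= u j.
  by move=> i j; apply: (@subdivision_le 0 n u).
have le_v : forall i j, (i <= j)%N -> (j <= m)%N -> v i <= v j.
  by move=> i j; apply: (@subdivision_le 0 m v).
have ut i : (i <= n)%N -> u i \in t.
  by move=> i_n; rewrite mem_sort mem_cat map_f// mem_iota add0n ltnS.
have vt i : (i <= m)%N -> v i \in t.
  by move=> i_n; rewrite mem_sort mem_cat orbC map_f// mem_iota add0n ltnS.
have tab x : x \in t -> a <= x <= b.
  rewrite mem_sort mem_cat => /orP[] /mapP[i];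
    rewrite mem_iota add0n ltnS => /= i_n ->.
    by rewrite -u0 -un !le_u.
  by rewrite -v0 -vm !le_v.
have st : sorted <=%R t by exact: sort_le_sorted.
have nth_le i j : (i <= j)%N -> (j < size t)%N -> nth a t i <= nth a t j.
  move=> ij jt; apply: (sorted_leq_nth le_trans lexx a st) => //.
  by rewrite inE (leq_ltn_trans ij).
have idx_le x z : x \in t -> z \in t -> x <= z -> (index x t <= index z t)%N.
  move=> xt zt xz; case: leqP => // zx.
  have := nth_le _ _ (ltnW zx); rewrite index_mem => /(_ xt).
  rewrite !nth_index// => zlex.
  by move: zx; have -> : x = z; [apply/le_anti; rewrite xz|rewrite ltnn].
have idx_a : index a t = 0%N.
  apply/eqP; rewrite -leqn0 leqNgt; apply/negP => a0.
  have at_ : a \in t by rewrite -u0 ut.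
  have := nth_le 0%N (index a t) (ltnW a0); rewrite index_mem => /(_ at_).
  rewrite (nth_index a at_) => la.
  have t0 : (0 < size t)%N.
    by rewrite (leq_ltn_trans _ (_ : (index a t < size t)%N))// index_mem.
  have /andP[al _] := tab _ (mem_nth a t0).
  have e : nth a t 0 = a by apply/le_anti; rewrite la.
  have := before_find a (a := pred1 a) a0.
  by rewrite /= e eqxx.
have bt : b \in t by rewrite -un ut.
exists (index b t), (nth a t).
exists (fun i => index (u i) t), (fun i => index (v i) t).
split; split.
- by rewrite -idx_a nth_index// -u0 ut.
- by rewrite nth_index.
- move=> i ib; apply: nth_le => //.
  by rewrite (leq_ltn_trans ib)// index_mem.
- by rewrite u0.
- by rewrite un.
- by move=> i i_n; rewrite idx_le ?ut// ?um// ltnW.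
- by move=> i i_n; rewrite nth_index ?ut.
- by rewrite v0.
- by rewrite vm.
- by move=> i i_n; rewrite idx_le ?vt// ?vmm// ltnW.
- by move=> i i_n; rewrite nth_index ?vt.
Qed.

End Sewing.

(** * Young's estimate in one variable *)

Section Young.
Context {R : realType}.

(** Halving [h] multiplies [2 * h `^ p] by [2 `^ (1 - p)], and this is at most
    [young_kappa theta] for all [theta <= p]: the minimum [theta] of several
    exponents gives one constant for all of them. *)
Definition young_kappa (theta : R) : R := 2 `^ (1 - theta).
Definition young_const (theta : R) : R := sewing_const (young_kappa theta).

Lemma young_kappa_lt1 theta : 1 < theta -> young_kappa theta < 1.
Proof.
move=> t1; rewrite -(powRr0 (2 : R)) /young_kappa.
rewrite /powR (_ : (2 == 0 :> R) = false); last by rewrite pnatr_eq0.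
by rewrite ltr_expR ltr_pM2r ?subr_lt0// ln_gt0// ltr1n.
Qed.

Lemma young_const_ge0 theta : 1 < theta -> 0 <= young_const theta.
Proof.
move=> t1; rewrite /young_const /sewing_const divr_ge0// subr_ge0.
exact/ltW/young_kappa_lt1.
Qed.

Lemma powRD_gt0 (h p q : R) : 0 < p + q -> h `^ (p + q) = h `^ p * h `^ q.
Proof. by move=> pq; rewrite powRD// gt_eqF. Qed.

Lemma powR_le (p h k : R) : 0 <= p -> 0 <= h -> h <= k -> h `^ p <= k `^ p.
Proof.
by move=> p0 h0 hk; rewrite ge0_ler_powR ?nnegrE ?h0// (le_trans h0).
Qed.

(** The germ f (s) * (g (t) - g (s)) has the defect
    (f (s) - f (r)) * (g (t) - g (r)). *)
Lemma young_sum (theta a b F G t1 t2 : R) (f g : R -> R) m (v : nat -> R) :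
  1 < theta -> 0 <= a -> 0 <= b -> theta <= a + b -> 0 <= F -> 0 <= G ->
  (forall t t', t1 <= t -> t <= t' -> t' <= t2 ->
     `|f t - f t'| <= F * (t' - t) `^ a) ->
  (forall t t', t1 <= t -> t <= t' -> t' <= t2 ->
     `|g t' - g t| <= G * (t' - t) `^ b) ->
  subdivision t1 t2 m v ->
  `|\sum_(j < m) f (v j) * (g (v j.+1) - g (v j))| <=
    G * (t2 - t1) `^ b * (`|f t1| + young_const theta * F * (t2 - t1) `^ a).
Proof.
move=> th1 a0 b0 thab F0 G0 Hf Hg Hv; have [v0 vm vmono] := Hv.
have ab0 : 0 < a + b by apply: lt_le_trans thab; apply: lt_trans th1.
have gg : gauge (young_kappa theta) (fun h => F * G * h `^ (a + b)).
  by apply: gaugeZ; [rewrite mulr_ge0|exact: gauge_powR].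
have t12 : t1 <= t2 by exact: subdivision_endpoints Hv.
have := @sewing _ _ _ (fun s t => f s * (g t - g s)) t1 t2
  (young_kappa_lt1 th1) gg _ v 0%N m (leq0n _).
rewrite v0 vm lexx => /(_ _ isT (lexx _) vmono); rewrite big_mkord => HS.
have {}HS := HS _; set S := \sum_(j < m) _ in HS *.
have {}HS : `|S - f t1 * (g t2 - g t1)| <=
    sewing_const (young_kappa theta) * (F * G * (t2 - t1) `^ (a + b)).
  apply: HS => s r t t1s sr rt tt2.
  rewrite (_ : _ - _ = (f s - f r) * (g t - g r)); last by ring.
  rewrite normrM powRD_gt0//.
  apply: (@le_trans _ _ ((F * (r - s) `^ a) * (G * (t - r) `^ b))).
    by rewrite ler_pM ?Hf ?Hg// ?(le_trans rt) ?(le_trans t1s).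
  rewrite mulrACA ler_wpM2l ?mulr_ge0// ler_pM ?powR_ge0// powR_le ?subr_ge0//.
    by rewrite lerD2r.
  by rewrite lerD2l lerN2.
have H0 : `|f t1 * (g t2 - g t1)| <= `|f t1| * (G * (t2 - t1) `^ b).
  by rewrite normrM ler_wpM2l// Hg.
rewrite -[S](subrK (f t1 * (g t2 - g t1))).
apply: (le_trans (ler_normD _ _)); apply: (le_trans (lerD HS H0)).
rewrite powRD_gt0// /young_const; lra.
Qed.

End Young.

(** * Riemann sums on grids *)

(** The exponents with all that is required of them, in a form that is
    symmetric under the exchange of the two variables: every statement on the
    first variable then yields its counterpart on the second one. *)
Record young_exponents (R : realType) := YoungExponents {
  exp_theta : R;
  exp_gamma : R; exp_gamma' : R;
  exp_rho : R; exp_rho' : R;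
  exp_alpha : R; exp_beta : R;
  exp_theta_gt1 : 1 < exp_theta;
  exp_gamma_ge0 : 0 <= exp_gamma; exp_gamma'_ge0 : 0 <= exp_gamma';
  exp_rho_ge0 : 0 <= exp_rho; exp_rho'_ge0 : 0 <= exp_rho';
  exp_alpha_ge0 : 0 <= exp_alpha; exp_beta_ge0 : 0 <= exp_beta;
  exp_theta_le_alpha : exp_theta <= exp_alpha + exp_gamma;
  exp_theta_le_rho : exp_theta <= exp_rho + exp_gamma;
  exp_theta_le_beta : exp_theta <= exp_beta + exp_gamma';
  exp_theta_le_rho' : exp_theta <= exp_rho' + exp_gamma' }.

Definition flip_exponents (R : realType) (e : young_exponents R) :=
  YoungExponents (exp_theta_gt1 e)
    (exp_gamma'_ge0 e) (exp_gamma_ge0 e) (exp_rho'_ge0 e) (exp_rho_ge0 e)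
    (exp_beta_ge0 e) (exp_alpha_ge0 e)
    (exp_theta_le_beta e) (exp_theta_le_rho' e)
    (exp_theta_le_alpha e) (exp_theta_le_rho e).

(** [const_x] and [const_y] bound rectangular increments of [x] and [y];
    [const_s] and [const_t] bound differences of [y] in the first and in the
    second variable (see [young_pair]). *)
Record holder_consts (R : realType) := HolderConsts {
  const_x : R; const_y : R; const_s : R; const_t : R;
  const_x_ge0 : 0 <= const_x; const_y_ge0 : 0 <= const_y;
  const_s_ge0 : 0 <= const_s; const_t_ge0 : 0 <= const_t }.

Definition flip_consts (R : realType) (c : holder_consts R) :=
  HolderConsts (const_x_ge0 c) (const_y_ge0 c) (const_t_ge0 c) (const_s_ge0 c).

Definition transpose (R : realType) (f : R * R -> R) : R * R -> R :=
  fun p => f (p.2, p.1).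

Section RiemannSums.
Context {R : realType}.
Implicit Types (e : young_exponents R) (c : holder_consts R) (x y : R * R -> R).

Definition rect_bound (s1 s2 t1 t2 M a b : R) (f : R * R -> R) : Prop :=
  forall s s' t t', s1 <= s -> s <= s' -> s' <= s2 ->
    t1 <= t -> t <= t' -> t' <= t2 ->
    `|rect_incr f s s' t t'| <= M * ((s' - s) `^ a * (t' - t) `^ b).

Definition row_bound (s1 s2 t1 t2 M a : R) (f : R * R -> R) : Prop :=
  forall s s' t, s1 <= s -> s <= s' -> s' <= s2 -> t1 <= t -> t <= t2 ->
    `|f (s, t) - f (s', t)| <= M * (s' - s) `^ a.

Definition young_pair e c (s1 s2 t1 t2 : R) x y : Prop :=
  [/\ rect_bound s1 s2 t1 t2 (const_x c) (exp_gamma e) (exp_gamma' e) x,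
      rect_bound s1 s2 t1 t2 (const_y c) (exp_rho e) (exp_rho' e) y,
      row_bound s1 s2 t1 t2 (const_s c) (exp_alpha e) y &
      row_bound t1 t2 s1 s2 (const_t c) (exp_beta e) (transpose y)].

Lemma rect_incr_transpose x s s' t t' :
  rect_incr (transpose x) t t' s s' = rect_incr x s s' t t'.
Proof. by rewrite /rect_incr /transpose /=; ring. Qed.

Lemma young_pair_transpose e c s1 s2 t1 t2 x y :
  young_pair e c s1 s2 t1 t2 x y ->
  young_pair (flip_exponents e) (flip_consts c) t1 t2 s1 s2
    (transpose x) (transpose y).
Proof.
move=> [Hx Hy H1 H2]; split => //=.
- by move=> s s' t t' *; rewrite rect_incr_transpose [X in _ * X]mulrC Hx.
- by move=> s s' t t' *; rewrite rect_incr_transpose [X in _ * X]mulrC Hy.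
Qed.

Lemma riemann_sum_transpose y x n m u v :
  riemann_sum (transpose y) (transpose x) m n v u = riemann_sum y x n m u v.
Proof.
rewrite /riemann_sum exchange_big; apply: eq_bigr => i _; apply: eq_bigr => j _.
by rewrite rect_incr_transpose.
Qed.

Definition row_germ y x m (v : nat -> R) (s s' : R) : R :=
  \sum_(j < m) y (s, v j) * rect_incr x s s' (v j) (v j.+1).

(** The bound that [young_sum] gives for the defect of [row_germ] over an
    interval of length [h], when the second variable ranges over an interval
    of length [T]. *)
Definition row_gauge e c (T h : R) : R :=
  const_x c * T `^ exp_gamma' e * (const_s c * h `^ (exp_alpha e + exp_gamma e)
    + young_const (exp_theta e) * const_y c * T `^ exp_rho' e *
      h `^ (exp_rho e + exp_gamma e)).

Lemma row_gaugeP e c T : gauge (young_kappa (exp_theta e)) (row_gauge e c T).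
Proof.
have c0 := young_const_ge0 (exp_theta_gt1 e).
apply: gaugeZ; first by rewrite mulr_ge0 ?powR_ge0 ?const_x_ge0.
apply: gaugeD; apply: gaugeZ.
- exact: const_s_ge0.
- by apply: gauge_powR; [exact: exp_theta_gt1|exact: exp_theta_le_alpha].
- by rewrite mulr_ge0 ?powR_ge0// mulr_ge0 ?const_y_ge0.
- by apply: gauge_powR; [exact: exp_theta_gt1|exact: exp_theta_le_rho].
Qed.

(** The defect is a Riemann sum in the second variable, of
    [y (s, .) - y (r, .)] against [x (s', .) - x (r, .)].  The bound does not
    depend on the subdivision [v]. *)
Lemma row_defect e c s1 s2 t1 t2 x y m v :
  young_pair e c s1 s2 t1 t2 x y -> subdivision t1 t2 m v ->
  forall s r s', s1 <= s -> s <= r -> r <= s' -> s' <= s2 ->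
  `|row_germ y x m v s s' - row_germ y x m v s r - row_germ y x m v r s'|
    <= row_gauge e c (t2 - t1) (s' - s).
Proof.
move=> [Hx Hy H1 _] Hv s r s' s1s sr rs' s's2.
have [v0 vm vmono] := Hv.
have t12 : t1 <= t2 by exact: subdivision_endpoints Hv.
have -> : row_germ y x m v s s' - row_germ y x m v s r - row_germ y x m v r s'
  = \sum_(j < m) (y (s, v j) - y (r, v j)) *
       ((x (s', v j.+1) - x (r, v j.+1)) - (x (s', v j) - x (r, v j))).
  rewrite /row_germ -!sumrB; apply: eq_bigr => j _.
  by rewrite /rect_incr; ring.
have rs2 : r <= s2 by exact: le_trans s's2.
have s1r : s1 <= r by exact: le_trans sr.
have := @young_sum _ _ _ _ (const_y c * (r - s) `^ exp_rho e)
  (const_x c * (s' - r) `^ exp_gamma e) t1 t2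
  (fun t => y (s, t) - y (r, t))
  (fun t => x (s', t) - x (r, t)) m v (exp_theta_gt1 e) (exp_rho'_ge0 e)
  (exp_gamma'_ge0 e) (exp_theta_le_rho' e) _ _ _ _ Hv.
have Y0 : 0 <= const_y c * (r - s) `^ exp_rho e.
  by rewrite mulr_ge0 ?powR_ge0 ?const_y_ge0.
have X0 : 0 <= const_x c * (s' - r) `^ exp_gamma e.
  by rewrite mulr_ge0 ?powR_ge0 ?const_x_ge0.
move=> /(_ Y0 X0); set S := \sum_(j < m) _ => HS.
have {}HS := HS _ _.
apply: (le_trans (HS _ _)).
- move=> t t' t1t tt' t't2; rewrite -mulrA.
  rewrite (_ : _ - _ = rect_incr y s r t t') ?Hy// /rect_incr; ring.
- move=> t t' t1t tt' t't2; rewrite -mulrA.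
  rewrite (_ : _ - _ = rect_incr x r s' t t') ?Hx// /rect_incr; ring.
rewrite /row_gauge.
have th0 : 0 < exp_theta e by apply: lt_trans (exp_theta_gt1 e).
rewrite !powRD_gt0 ?(lt_le_trans th0) ?exp_theta_le_alpha ?exp_theta_le_rho//.
set T := t2 - t1; set c0 := young_const _.
have c00 : 0 <= c0 by apply: young_const_ge0; exact: exp_theta_gt1.
rewrite [leRHS](_ : _ = const_x c * T `^ exp_gamma' e *
  ((s' - s) `^ exp_gamma e * (const_s c * (s' - s) `^ exp_alpha e +
     c0 * (const_y c * (s' - s) `^ exp_rho e) * T `^ exp_rho' e)));
  last by ring.
rewrite [leLHS](_ : _ = const_x c * T `^ exp_gamma' e *
  ((s' - r) `^ exp_gamma e * (`|y (s, t1) - y (r, t1)| +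
     c0 * (const_y c * (r - s) `^ exp_rho e) * T `^ exp_rho' e)));
  last by ring.
rewrite ler_wpM2l ?mulr_ge0 ?powR_ge0 ?const_x_ge0//.
have le1 : r - s <= s' - s by rewrite lerD2r.
have le2 : s' - r <= s' - s by rewrite lerD2l lerN2.
apply: ler_pM; rewrite ?powR_ge0//.
- by rewrite addr_ge0// mulr_ge0 ?powR_ge0// mulr_ge0.
- by rewrite powR_le ?subr_ge0 ?exp_gamma_ge0.
- apply: lerD.
    apply: (le_trans (H1 s r t1 _ _ _ _ _)) => //.
    by rewrite ler_wpM2l ?const_s_ge0// powR_le ?subr_ge0 ?exp_alpha_ge0.
  rewrite ler_wpM2r ?powR_ge0// ler_wpM2l// ler_wpM2l ?const_y_ge0//.
  by rewrite powR_le ?subr_ge0 ?exp_rho_ge0.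
Qed.

Definition row_err e c (T : R) n (u : nat -> R) : R :=
  \sum_(i < n) young_const (exp_theta e) * row_gauge e c T (u i.+1 - u i).

Definition col_err e c (S : R) m (v : nat -> R) : R :=
  row_err (flip_exponents e) (flip_consts c) S m v.

Lemma riemann_sum_refine e c s1 s2 t1 t2 x y m v N w n u sigma :
  young_pair e c s1 s2 t1 t2 x y -> subdivision t1 t2 m v ->
  subdivision s1 s2 N w ->
  [/\ sigma 0%N = 0%N, sigma n = N,
    forall i, (i < n)%N -> (sigma i <= sigma i.+1)%N &
    forall i, (i <= n)%N -> w (sigma i) = u i] ->
  `|riemann_sum y x N m w v - riemann_sum y x n m u v|
     <= row_err e c (t2 - t1) n u.
Proof.
move=> Hp Hv Hw [sg0 sgn sgm sgu].
have := @sewing_refine _ _ _ (row_germ y x m v) s1 s2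
  (young_kappa_lt1 (exp_theta_gt1 e)) (row_gaugeP e c (t2 - t1))
  (row_defect Hp Hv) w N sigma n Hw sg0 sgn sgm.
rewrite -/(riemann_sum y x N m w v).
have -> : \sum_(i < n) row_germ y x m v (w (sigma i)) (w (sigma i.+1)) =
    riemann_sum y x n m u v.
  by apply: eq_bigr => i _; rewrite !sgu// ltnW.
move=> /le_trans; apply; rewrite le_eqVlt; apply/orP; left; apply/eqP.
by apply: eq_bigr => i _; rewrite !sgu// ltnW.
Qed.

(** Both sums are compared with the one on the common refinement of the two
    grids.  Refining first in one variable and then in the other keeps each
    error dependent on the original steps only, because the errors of
    [riemann_sum_refine] do not see the subdivision of the other variable. *)
Lemma riemann_sum_dist e c s1 s2 t1 t2 x y n1 u1 m1 v1 n2 u2 m2 v2 :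
  young_pair e c s1 s2 t1 t2 x y ->
  subdivision s1 s2 n1 u1 -> subdivision t1 t2 m1 v1 ->
  subdivision s1 s2 n2 u2 -> subdivision t1 t2 m2 v2 ->
  `|riemann_sum y x n1 m1 u1 v1 - riemann_sum y x n2 m2 u2 v2| <=
    (row_err e c (t2 - t1) n1 u1 + col_err e c (s2 - s1) m1 v1) +
    (row_err e c (t2 - t1) n2 u2 + col_err e c (s2 - s1) m2 v2).
Proof.
move=> Hp Hu1 Hv1 Hu2 Hv2.
have [N [w [sg [tg [Hw Hsg Htg]]]]] := common_refinement Hu1 Hu2.
have [M [z [sh [th [Hz Hsh Hth]]]]] := common_refinement Hv1 Hv2.
have Hp' := young_pair_transpose Hp.
have A1 := riemann_sum_refine Hp Hv1 Hw Hsg.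
have A2 := riemann_sum_refine Hp Hv2 Hw Htg.
have B1 := riemann_sum_refine Hp' Hw Hz Hsh.
have B2 := riemann_sum_refine Hp' Hw Hz Hth.
rewrite !riemann_sum_transpose -!/(col_err _ _ _ _ _) in B1 B2.
move: A1 A2 B1 B2.
set a := riemann_sum _ _ n1 _ _ _; set b := riemann_sum _ _ n2 _ _ _.
set a' := riemann_sum _ _ N m1 _ _; set b' := riemann_sum _ _ N m2 _ _.
set d := riemann_sum _ _ N M _ _ => A1 A2 B1 B2.
rewrite [X in _ <= X](_ : _ =
  col_err e c (s2 - s1) m1 v1 + row_err e c (t2 - t1) n1 u1 +
  (col_err e c (s2 - s1) m2 v2 + row_err e c (t2 - t1) n2 u2)); last by ring.
apply: (le_trans (ler_distD d _ _)); apply: lerD.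
  rewrite distrC; apply: (le_trans (ler_distD a' _ _)); exact: lerD.
apply: (le_trans (ler_distD b' _ _)); exact: lerD.
Qed.

End RiemannSums.

(** * Existence and size of the integral *)

Section Limit.
Context {R : realType}.
Implicit Types (e : young_exponents R) (c : holder_consts R) (x y : R * R -> R).

Definition trivial_subdivision (a b : R) : nat -> R :=
  fun i => if i == 0%N then a else b.

Lemma trivial_subdivisionP (a b : R) : a <= b ->
  subdivision a b 1 (trivial_subdivision a b).
Proof. by move=> ab; split => // -[|i]. Qed.

(** By [riemann_sum_dist] every lower bound S - err is below every upper bound
    S' + err', so the supremum of the lower bounds lies between all of them. *)
Lemma riemann_limit_exists e c s1 s2 t1 t2 x y :
  young_pair e c s1 s2 t1 t2 x y -> s1 <= s2 -> t1 <= t2 ->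
  exists z, forall n u m v, subdivision s1 s2 n u -> subdivision t1 t2 m v ->
    `|riemann_sum y x n m u v - z| <=
       row_err e c (t2 - t1) n u + col_err e c (s2 - s1) m v.
Proof.
move=> Hp s12 t12.
pose err n u m v := row_err e c (t2 - t1) n u + col_err e c (s2 - s1) m v.
pose E := [set r | exists n u m v, [/\ subdivision s1 s2 n u,
  subdivision t1 t2 m v & r = riemann_sum y x n m u v - err n u m v]].
have ubE n u m v : subdivision s1 s2 n u -> subdivision t1 t2 m v ->
    ubound E (riemann_sum y x n m u v + err n u m v).
  move=> Hu Hv _ [n' [u' [m' [v' [Hu' Hv' ->]]]]].
  have := riemann_sum_dist Hp Hu' Hv' Hu Hv.
  rewrite -!/(err _ _ _ _) => /(le_trans (ler_norm _)); lra.
have E0 : E !=set0.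
  pose u := trivial_subdivision s1 s2; pose v := trivial_subdivision t1 t2.
  exists (riemann_sum y x 1 1 u v - err 1%N u 1%N v).
  by do 4 eexists; split; [exact: trivial_subdivisionP..|].
exists (sup E) => n u m v Hu Hv; rewrite -/(err n u m v) ler_distlC.
apply/andP; split.
  apply: sup_upper_bound; last by exists n, u, m, v.
  by split=> //; eexists; exact: (ubE n u m v).
by apply: ge_sup => //; exact: ubE.
Qed.

(** Once the mesh is small, phi (h) <= eps * h on every step, and the steps add
    up to the length of the interval. *)
Lemma row_err_cvg e c T s1 s2 k u : partition_family s1 s2 k u ->
  row_err e c T (k delta) (u delta) @[delta --> 0^'+] --> (0 : R).
Proof.
move=> [Hsub Hmesh].
have g : gauge (young_kappa (exp_theta e))
    (fun h => young_const (exp_theta e) * row_gauge e c T h).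
  apply: gaugeZ; last exact: row_gaugeP.
  by apply: young_const_ge0; exact: exp_theta_gt1.
have [_ _ _ small] := g.
have s12 : s1 <= s2 by exact: subdivision_endpoints (Hsub 1 ltr01).
(* The summand 1 covers the degenerate case of an interval of length zero. *)
have l0 : 0 < s2 - s1 + 1 by rewrite ltr_wpDl ?subr_ge0.
apply/cvgrPdist_le => eps eps0.
have [d d0 Hd] := small (eps / (s2 - s1 + 1)) (divr_gt0 eps0 l0).
move/cvgrPdist_le : Hmesh => /(_ d d0) Hmesh.
near=> delta.
have delta0 : 0 < delta by near: delta; exact: nbhs_right_gt.
have Hm : `|0 - mesh (k delta) (u delta)| <= d by near: delta.
have [u0 un um] := Hsub delta delta0.
have step i : (i < k delta)%N -> u delta i.+1 - u delta i <= d.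
  move=> ik; apply: le_trans Hm; rewrite sub0r normrN.
  apply: le_trans (ler_norm _).
  exact: (le_bigmax _ (fun i : 'I__ => u delta i.+1 - u delta i) (Ordinal ik)).
rewrite sub0r normrN ger0_norm; last first.
  apply: sumr_ge0 => i _; apply: (gauge_ge0 g).
  by rewrite subr_ge0 um.
apply: (@le_trans _ _ (\sum_(i < k delta)
    eps / (s2 - s1 + 1) * (u delta i.+1 - u delta i))).
  by apply: ler_sum => i _; rewrite Hd ?step// subr_ge0 um.
rewrite -mulr_sumr -(big_mkord xpredT (fun i => u delta i.+1 - u delta i)).
rewrite telescope_sumr// u0 un mulrAC ler_pdivrMr// ler_wpM2l ?(ltW eps0)//.
by rewrite lerDl.
Unshelve. all: by end_near. Qed.

Lemma riemann_sums_cvg_err e c s1 s2 t1 t2 x y z :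
  (forall n u m v, subdivision s1 s2 n u -> subdivision t1 t2 m v ->
    `|riemann_sum y x n m u v - z| <=
       row_err e c (t2 - t1) n u + col_err e c (s2 - s1) m v) ->
  riemann_sums_cvg y x s1 s2 t1 t2 z.
Proof.
move=> Hz k k' u v Hu Hv.
have cvg0 : row_err e c (t2 - t1) (k delta) (u delta) +
    col_err e c (s2 - s1) (k' delta) (v delta) @[delta --> 0^'+] --> (0 : R).
  by rewrite -[X in _ --> X]addr0; apply: cvgD;
    [exact: row_err_cvg Hu|exact: row_err_cvg Hv].
apply/cvgrPdist_le => eps eps0; move/cvgrPdist_le : cvg0 => /(_ _ eps0) cvg0.
near=> delta.
have delta0 : 0 < delta by near: delta; exact: nbhs_right_gt.
rewrite distrC.
apply: (le_trans (Hz _ _ _ _ (Hu.1 delta delta0) (Hv.1 delta delta0))).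
apply: (le_trans (ler_norm _)); rewrite -normrN -sub0r.
by near: delta.
Unshelve. all: by end_near. Qed.

(** Without a family of partitions with vanishing mesh every number would be a
    limit of the Riemann sums; the uniform subdivisions provide one. *)
Lemma partition_family_exists (a b : R) : a <= b ->
  exists k u, partition_family a b k u.
Proof.
move=> ab.
pose k (delta : R) := (Num.truncn (delta^-1)).+1.
pose u (delta : R) (i : nat) := a + (b - a) * (i%:R / (k delta)%:R).
have step delta i : u delta i.+1 - u delta i = (b - a) / (k delta)%:R.
  by rewrite /u -natr1; ring.
have k0 delta : 0 < (k delta)%:R :> R by rewrite ltr0n.
exists k, u; split.
  move=> delta _; split.
  - by rewrite /u mul0r mulr0 addr0.
  - by rewrite /u divff ?gt_eqF// mulr1 addrC subrK.
  - by move=> i _; rewrite -subr_ge0 step divr_ge0 ?subr_ge0// ltW.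
apply: (@squeeze_cvgr _ _ _ _ (fun=> 0) (fun delta => (b - a) * delta)).
- near=> delta.
  have delta0 : 0 < delta by near: delta; exact: nbhs_right_gt.
  apply/andP; split; first exact: bigmax_ge_id.
  apply: bigmax_le => [|i _]; first by rewrite mulr_ge0 ?subr_ge0// ltW.
  rewrite step ler_wpM2l ?subr_ge0// -[leRHS]invrK lef_pV2 ?posrE ?invr_gt0//.
  exact/ltW/truncnS_gt.
- exact: cvg_cst.
- rewrite -[X in _ --> X](mulr0 (b - a)); apply: cvgM; first exact: cvg_cst.
  exact/cvg_at_right_filter/cvg_id.
Unshelve. all: by end_near. Qed.

Lemma riemann_sums_cvg_unique y x s1 s2 t1 t2 z z' : s1 <= s2 -> t1 <= t2 ->
  riemann_sums_cvg y x s1 s2 t1 t2 z -> riemann_sums_cvg y x s1 s2 t1 t2 z' ->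
  z = z'.
Proof.
move=> s12 t12 Hz Hz'.
have [k [u Hu]] := partition_family_exists s12.
have [k' [v Hv]] := partition_family_exists t12.
have cz := Hz _ _ _ _ Hu Hv; have cz' := Hz' _ _ _ _ Hu Hv.
exact: (cvg_unique (@norm_hausdorff R R) cz cz').
Qed.

Lemma rect_integral_unique y x s1 s2 t1 t2 z : s1 <= s2 -> t1 <= t2 ->
  riemann_sums_cvg y x s1 s2 t1 t2 z -> rect_integral y x s1 s2 t1 t2 = z.
Proof.
move=> s12 t12 Hz; apply: (@riemann_sums_cvg_unique y x s1 s2 t1 t2) => //.
by apply: (@getPex _ [set z | riemann_sums_cvg y x s1 s2 t1 t2 z]); exists z.
Qed.

Lemma rect_integralP e c s1 s2 t1 t2 x y :
  young_pair e c s1 s2 t1 t2 x y -> s1 <= s2 -> t1 <= t2 ->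
  riemann_sums_cvg y x s1 s2 t1 t2 (rect_integral y x s1 s2 t1 t2).
Proof.
move=> Hp s12 t12.
have [z /riemann_sums_cvg_err Hz] := riemann_limit_exists Hp s12 t12.
by rewrite (rect_integral_unique s12 t12 Hz).
Qed.

(** The estimate of [riemann_limit_exists] for the grid with one rectangle. *)
Lemma rect_integral_bound e c s1 s2 t1 t2 x y :
  young_pair e c s1 s2 t1 t2 x y -> s1 <= s2 -> t1 <= t2 ->
  `|rect_integral y x s1 s2 t1 t2| <=
    const_x c * ((s2 - s1) `^ exp_gamma e * (t2 - t1) `^ exp_gamma' e) *
    (`|y (s1, t1)|
     + young_const (exp_theta e) * (const_s c * (s2 - s1) `^ exp_alpha e)
     + young_const (exp_theta e) * (const_t c * (t2 - t1) `^ exp_beta e)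
     + 2 * young_const (exp_theta e) ^+ 2 *
       (const_y c * ((s2 - s1) `^ exp_rho e * (t2 - t1) `^ exp_rho' e))).
Proof.
move=> Hp s12 t12.
set C := young_const _; set S := s2 - s1; set T := t2 - t1.
have [z Hz] := riemann_limit_exists Hp s12 t12.
rewrite (@rect_integral_unique _ _ _ _ _ _ z)//;
  last exact: riemann_sums_cvg_err Hz.
have := Hz _ _ _ _ (trivial_subdivisionP s12) (trivial_subdivisionP t12).
rewrite /col_err /riemann_sum /row_err !big_ord1 /= -/C -/S -/T => {}Hz.
have [Hx _ _ _] := Hp.
have H0 : `|y (s1, t1) * rect_incr x s1 s2 t1 t2| <=
    `|y (s1, t1)| * (const_x c * (S `^ exp_gamma e * T `^ exp_gamma' e)).
  by rewrite normrM ler_wpM2l// Hx.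
have th0 : 0 < exp_theta e by apply: lt_trans (exp_theta_gt1 e).
have {Hz H0} : `|z| <=
    `|y (s1, t1)| * (const_x c * (S `^ exp_gamma e * T `^ exp_gamma' e)) +
    (C * row_gauge e c T S
       + C * row_gauge (flip_exponents e) (flip_consts c) S T).
  rewrite -[z](subKr (y (s1, t1) * rect_incr x s1 s2 t1 t2)).
  by rewrite (le_trans (ler_normB _ _))// lerD.
move=> /le_trans; apply; rewrite /row_gauge /= -/C.
rewrite !powRD_gt0 ?(lt_le_trans th0) ?exp_theta_le_alpha ?exp_theta_le_rho
  ?exp_theta_le_beta ?exp_theta_le_rho'//.
rewrite le_eqVlt; apply/orP; left; apply/eqP; ring.
Qed.

End Limit.

(** * From norms to bounds *)

Section Norms.
Context {R : realType}.
Implicit Types (x y f : R * R -> R).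

Lemma rect_subset (s1 s2 t1 t2 s s' t t' : R) : s <= s' -> t <= t' ->
  rect s s' t t' `<=` rect s1 s2 t1 t2 <->
  [/\ s1 <= s, s' <= s2, t1 <= t & t' <= t2].
Proof.
move=> ss' tt'; split.
  move=> sub.
  have /sub[/=] : rect s s' t t' (s, t).
    by rewrite /rect /= !in_itv /= !lexx ss' tt'.
  have /sub[/=] : rect s s' t t' (s', t').
    by rewrite /rect /= !in_itv /= !lexx ss' tt'.
  by rewrite !in_itv /= => /andP[_ ?] /andP[_ ?] /andP[? _] /andP[? _].
move=> [h1 h2 h3 h4] [a b] [/=]; rewrite !in_itv /= => /andP[sa as'] /andP[tb bt'].
split; rewrite /= in_itv /=; apply/andP; split.
- exact: le_trans sa.
- exact: le_trans as' _.
- exact: le_trans tb.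
- exact: le_trans bt' _.
Qed.

Lemma powR_dist_gt0 (a b p : R) : a < b -> 0 < `|b - a| `^ p.
Proof. by move=> ab; rewrite powR_gt0// normr_gt0 subr_eq0 gt_eqF. Qed.

(** The norm is a supremum over non-degenerate rectangles; on the degenerate
    ones, which subdivisions with repeated points produce, the increment
    vanishes. *)
Lemma rect_norm_bound (s1 s2 t1 t2 a b : R) f : s1 < s2 -> t1 < t2 ->
  (rect_norm (rect s1 s2 t1 t2) a b f < +oo)%E ->
  exists M, [/\ rect_norm (rect s1 s2 t1 t2) a b f = M%:E, 0 <= M &
    rect_bound s1 s2 t1 t2 M a b f].
Proof.
move=> s12 t12 fin; set N := rect_norm _ _ _ _ in fin *.
have ub s s' t t' : s < s' -> t < t' ->
  s1 <= s -> s' <= s2 -> t1 <= t -> t' <= t2 ->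
  ((`|rect_incr f s s' t t'| / (`|s' - s| `^ a * `|t' - t| `^ b))%:E <= N)%E.
  move=> ss' tt' *; apply: ereal_sup_ubound; exists s, s', t, t'; split=> //.
  by apply/rect_subset => //; exact: ltW.
have N0 : (0 <= N)%E.
  apply: le_trans (ub s1 s2 t1 t2 s12 t12 (lexx _) (lexx _) (lexx _) (lexx _)).
  by rewrite lee_fin divr_ge0// mulr_ge0 ?powR_ge0.
have Nfin : N \is a fin_num by rewrite ge0_fin_numE.
exists (fine N); split; first by rewrite fineK.
  exact: fine_ge0.
move=> s s' t t' s1s; rewrite le_eqVlt => /orP[/eqP<- _|ss' s's2].
  move=> *; rewrite /rect_incr (_ : _ + _ = 0); last by ring.
  by rewrite normr0 mulr_ge0 ?fine_ge0// mulr_ge0 ?powR_ge0.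
move=> t1t; rewrite le_eqVlt => /orP[/eqP<- _|tt' t't2].
  rewrite /rect_incr (_ : _ + _ = 0); last by ring.
  by rewrite normr0 mulr_ge0 ?fine_ge0// mulr_ge0 ?powR_ge0.
have := ub s s' t t' ss' tt' s1s s's2 t1t t't2.
rewrite -[N in X in X -> _](fineK Nfin) lee_fin ler_pdivrMr; last first.
  by rewrite mulr_gt0 ?powR_dist_gt0.
by rewrite [`|s' - s|]gtr0_norm ?subr_gt0// [`|t' - t|]gtr0_norm ?subr_gt0.
Qed.

(** Some Hoelder constant [K] makes the norm finite, and then the norm itself
    is a Hoelder constant. *)
Lemma holder_norm1_bound (s1 s2 t1 t2 a K : R) f : s1 < s2 -> t1 <= t2 ->
  row_bound s1 s2 t1 t2 K a f ->
  exists M, [/\ holder_norm1 (rect s1 s2 t1 t2) a f = M%:E, 0 <= M &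
    row_bound s1 s2 t1 t2 M a f].
Proof.
move=> s12 t12 HK; set N := holder_norm1 _ _ _.
have inD s t : s1 <= s -> s <= s2 -> t1 <= t -> t <= t2 ->
    rect s1 s2 t1 t2 (s, t).
  by move=> h1 h2 h3 h4; rewrite /rect /= !in_itv /= h1 h2 h3 h4.
have ub s s' t : s < s' -> s1 <= s -> s' <= s2 -> t1 <= t -> t <= t2 ->
  ((`|f (s, t) - f (s', t)| / `|s - s'| `^ a)%:E <= N)%E.
  move=> ss' *; apply: ereal_sup_ubound; exists s, s', t; split=> //.
  - by rewrite lt_eqF.
  - by apply: inD => //; rewrite (le_trans (ltW ss')).
  - by apply: inD => //; rewrite (le_trans _ (ltW ss')).
have N0 : (0 <= N)%E.
  apply: le_trans (ub s1 s2 t1 s12 (lexx _) (lexx _) (lexx _) t12).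
  by rewrite lee_fin divr_ge0// powR_ge0.
have NK : (N <= K%:E)%E.
  apply: ge_ereal_sup => _ [s [s' [t [ss' [/= + +] [/= + _] ->]]]].
  rewrite !in_itv /= => /andP[s1s ss2] /andP[t1t tt2] /andP[s1s' s's2].
  rewrite lee_fin.
  rewrite ler_pdivrMr; last by rewrite powR_gt0// normr_gt0 subr_eq0.
  have [s_s'|s_s'] := leP s s'.
    by rewrite [X in _ * X `^ _]distrC [X in _ * X `^ _]ger0_norm ?subr_ge0// HK.
  rewrite distrC [X in _ * X `^ _]gtr0_norm ?subr_gt0//.
  by rewrite HK// ltW.
have Nfin : N \is a fin_num by rewrite ge0_fin_numE// (le_lt_trans NK)// ltry.
exists (fine N); split; first by rewrite fineK.
  exact: fine_ge0.
move=> s s' t s1s; rewrite le_eqVlt => /orP[/eqP<- _|ss' s's2] t1t tt2.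
  by rewrite subrr normr0 mulr_ge0 ?fine_ge0// powR_ge0.
have := ub s s' t ss' s1s s's2 t1t tt2.
rewrite -[N in X in X -> _](fineK Nfin) lee_fin ler_pdivrMr; last first.
  by rewrite powR_gt0// normr_gt0 subr_eq0 lt_eqF.
by rewrite (distrC s s') [`|s' - s|]gtr0_norm ?subr_gt0.
Qed.

Lemma holder_norm2_transpose (s1 s2 t1 t2 b : R) f :
  holder_norm2 (rect s1 s2 t1 t2) b f =
  holder_norm1 (rect t1 t2 s1 s2) b (transpose f).
Proof.
congr ereal_sup; apply/seteqP; split => r /=.
  by move=> [s [t [t' [tt' [? ?] [? ?] ->]]]]; exists t, t', s; split.
by move=> [t [t' [s [tt' [? ?] [? ?] ->]]]]; exists s, t, t'; split.
Qed.

Lemma holder_cond_bounds (s1 s2 t1 t2 a b : R) f :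
  holder_cond s1 s2 t1 t2 a b f -> exists K K', [/\ 0 <= K, 0 <= K',
    row_bound s1 s2 t1 t2 K a f & row_bound t1 t2 s1 s2 K' b (transpose f)].
Proof.
move=> [K [K' [K0 K'0 H1 H2]]]; exists K, K'; split; [exact: ltW|exact: ltW| |].
  move=> s s' t s1s ss' s's2 t1t tt2.
  rewrite -[X in _ * X `^ _]ger0_norm ?subr_ge0// [X in _ * X `^ _]distrC.
  by rewrite H1 ?in_itv /= ?s1s ?s's2 ?t1t ?tt2 ?(le_trans s1s)// (le_trans ss').
move=> s s' t s1s ss' s's2 t1t tt2.
rewrite -[X in _ * X `^ _]ger0_norm ?subr_ge0// [X in _ * X `^ _]distrC.
by rewrite H2 ?in_itv /= ?s1s ?s's2 ?t1t ?tt2 ?(le_trans s1s)// (le_trans ss').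
Qed.

End Norms.

(** * Additivity of the integral *)

Section Additivity.
Context {R : realType}.
Implicit Types (e : young_exponents R) (c : holder_consts R) (x y : R * R -> R).

Definition concat (n : nat) (u u' : nat -> R) : nat -> R :=
  fun i => if (i < n)%N then u i else u' (i - n)%N.

Lemma concat_l n u u' i : u n = u' 0%N -> (i <= n)%N -> concat n u u' i = u i.
Proof.
move=> uu'; rewrite leq_eqVlt => /orP[/eqP ->|i_n]; rewrite /concat.
  by rewrite ltnn subnn.
by rewrite i_n.
Qed.

Lemma concat_r n u u' i : concat n u u' (n + i)%N = u' i.
Proof. by rewrite /concat ltnNge leq_addr /= addKn. Qed.

Lemma partition_family_concat (a b c : R) k u k' u' :
  partition_family a b k u -> partition_family b c k' u' ->
  partition_family a c (fun delta => k delta + k' delta)%N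
    (fun delta => concat (k delta) (u delta) (u' delta)).
Proof.
move=> [Hu mu] [Hu' mu']; split.
  move=> delta /[dup] /Hu[u0 un um] /Hu'[u0' un' um'].
  have uu' : u delta (k delta) = u' delta 0%N by rewrite un u0'.
  split.
  - by rewrite concat_l.
  - by rewrite concat_r.
  - move=> i; case: (ltnP i (k delta)) => [ik _|ki].
      by rewrite !concat_l// ?um// ltnW.
    by rewrite -(subnKC ki) ltn_add2l -addnS !concat_r => /um'.
have m0 : mesh (k delta) (u delta) + mesh (k' delta) (u' delta)
    @[delta --> 0^'+] --> (0 : R).
  by rewrite -[X in _ --> X]addr0; exact: cvgD.
apply: (@squeeze_cvgr _ _ _ _ (fun=> 0) (fun delta =>
  mesh (k delta) (u delta) + mesh (k' delta) (u' delta)));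
  [|exact: cvg_cst|exact: m0].
near=> delta.
have delta0 : 0 < delta by near: delta; exact: nbhs_right_gt.
have [[u0 un um] [u0' un' um']] := (Hu delta delta0, Hu' delta delta0).
have uu' : u delta (k delta) = u' delta 0%N by rewrite un u0'.
have mge0 n w : 0 <= mesh n w :> R by exact: bigmax_ge_id.
apply/andP; split; first exact: mge0.
apply: bigmax_le => [|i _]; first by rewrite addr_ge0.
case: (ltnP i (k delta)) => [ik|ki].
  rewrite !concat_l// ?(ltnW ik)// -[leLHS]addr0 lerD//.
  exact: (le_bigmax _ (fun i : 'I__ => u delta i.+1 - u delta i) (Ordinal ik)).
have ik' : (i - k delta < k' delta)%N by rewrite -(ltn_add2l (k delta)) subnKC.
rewrite -(subnKC ki) -addnS !concat_r -[leLHS]add0r lerD//.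
exact: (le_bigmax _ (fun i : 'I__ => u' delta i.+1 - u' delta i) (Ordinal ik')).
Unshelve. all: by end_near. Qed.

Lemma riemann_sum_concat y x n n' m u u' v : u n = u' 0%N ->
  riemann_sum y x (n + n') m (concat n u u') v =
  riemann_sum y x n m u v + riemann_sum y x n' m u' v.
Proof.
move=> uu'; rewrite /riemann_sum big_split_ord /=; congr (_ + _);
  apply: eq_bigr => i _; apply: eq_bigr => j _.
  by rewrite !concat_l// ltnW.
by rewrite -addnS !concat_r.
Qed.

(** Concatenated families of partitions are among the families along which the
    Riemann sums on the union converge. *)
Lemma riemann_sums_cvg_add y x s1 s2 s3 t1 t2 z z' z'' :
  s1 <= s2 -> s2 <= s3 -> t1 <= t2 ->
  riemann_sums_cvg y x s1 s2 t1 t2 z -> riemann_sums_cvg y x s2 s3 t1 t2 z' ->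
  riemann_sums_cvg y x s1 s3 t1 t2 z'' -> z'' = z + z'.
Proof.
move=> s12 s23 t12 Hz Hz' Hz''.
have [k [u Hu]] := partition_family_exists s12.
have [k' [u' Hu']] := partition_family_exists s23.
have [l [v Hv]] := partition_family_exists t12.
have H'' := Hz'' _ _ _ _ (partition_family_concat Hu Hu') Hv.
have H' : riemann_sum y x (k delta) (l delta) (u delta) (v delta) +
   riemann_sum y x (k' delta) (l delta) (u' delta) (v delta)
   @[delta --> 0^'+] --> z + z' by apply: cvgD; [exact: Hz|exact: Hz'].
apply: (cvg_unique (@norm_hausdorff R R) H'').
apply: cvg_trans H'; apply: near_eq_cvg; near=> delta.
have delta0 : 0 < delta by near: delta; exact: nbhs_right_gt.
rewrite riemann_sum_concat//.
by have [_ -> _] := Hu.1 _ delta0; have [-> _ _] := Hu'.1 _ delta0.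
Unshelve. all: by end_near. Qed.

Lemma riemann_sums_cvg_transpose y x s1 s2 t1 t2 z :
  riemann_sums_cvg y x s1 s2 t1 t2 z ->
  riemann_sums_cvg (transpose y) (transpose x) t1 t2 s1 s2 z.
Proof.
move=> Hz k k' u v Hu Hv; have := Hz _ _ _ _ Hv Hu.
by under eq_fun do rewrite -riemann_sum_transpose.
Qed.

Lemma young_pair_sub e c s1 s2 t1 t2 s1' s2' t1' t2' x y :
  s1 <= s1' -> s2' <= s2 -> t1 <= t1' -> t2' <= t2 ->
  young_pair e c s1 s2 t1 t2 x y -> young_pair e c s1' s2' t1' t2' x y.
Proof.
move=> h1 h2 h3 h4 [Hx Hy H1 H2]; split.
- move=> s s' t t' a1 a2 a3 a4 a5 a6.
  by apply: Hx => //; [exact: le_trans a1|exact: le_trans h2|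
    exact: le_trans a4|exact: le_trans h4].
- move=> s s' t t' a1 a2 a3 a4 a5 a6.
  by apply: Hy => //; [exact: le_trans a1|exact: le_trans h2|
    exact: le_trans a4|exact: le_trans h4].
- move=> s s' t a1 a2 a3 a4 a5.
  by apply: H1 => //; [exact: le_trans a1|exact: le_trans h2|
    exact: le_trans a4|exact: le_trans h4].
- move=> s s' t a1 a2 a3 a4 a5.
  by apply: H2 => //; [exact: le_trans a1|exact: le_trans h4|
    exact: le_trans a4|exact: le_trans h2].
Qed.

(** A primitive: the integral over the rectangle with opposite corners
    [(s0, t0)] and [p]. *)
Definition area y x (s0 t0 : R) (p : R * R) : R :=
  rect_integral y x s0 p.1 t0 p.2.

Lemma rect_integral_area e c s0 s1 t0 t1 x y :
  young_pair e c s0 s1 t0 t1 x y ->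
  forall s s' t t', s0 <= s -> s <= s' -> s' <= s1 ->
    t0 <= t -> t <= t' -> t' <= t1 ->
  rect_integral y x s s' t t' = rect_incr (area y x s0 t0) s s' t t'.
Proof.
move=> Hp s s' t t' h1 h2 h3 h4 h5 h6.
have I a a' b b' : s0 <= a -> a <= a' -> a' <= s1 ->
    t0 <= b -> b <= b' -> b' <= t1 ->
    riemann_sums_cvg y x a a' b b' (rect_integral y x a a' b b').
  move=> *; apply: (@rect_integralP _ e c) => //.
  by apply: young_pair_sub Hp.
have s0s' := le_trans h1 h2; have t0t' := le_trans h4 h5.
have ss1 := le_trans h2 h3; have tt1 := le_trans h5 h6.
have A := riemann_sums_cvg_add h1 h2 h5
  (I s0 s t t' _ _ _ _ _ _) (I s s' t t' _ _ _ _ _ _)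
  (I s0 s' t t' _ _ _ _ _ _).
have col a : s0 <= a -> a <= s1 -> rect_integral y x s0 a t0 t' =
    rect_integral y x s0 a t0 t + rect_integral y x s0 a t t'.
  move=> a0 a1.
  apply: (@riemann_sums_cvg_add (transpose y) (transpose x) t0 t t' s0 a) => //;
    by apply/riemann_sums_cvg_transpose/I.
rewrite /rect_incr /area /= !col// A//; ring.
Qed.

(** The rectangular increment changes sign when the endpoints of one variable
    are exchanged and vanishes when they coincide, exactly as prescribed for
    the oriented integral. *)
Lemma oriented_integral_area e c s0 s1 t0 t1 x y p q :
  young_pair e c s0 s1 t0 t1 x y -> rect s0 s1 t0 t1 p -> rect s0 s1 t0 t1 q ->
  oriented_integral y x p q = rect_incr (area y x s0 t0) p.1 q.1 p.2 q.2.
Proof.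
move=> /rect_integral_area H [/=]; rewrite !in_itv /= => /andP[a1 a2] /andP[a3 a4].
move=> [/=]; rewrite !in_itv /= => /andP[b1 b2] /andP[b3 b4].
rewrite /oriented_integral.
have [pq1|pq1|->] := ltgtP p.1 q.1.
- rewrite gtr0_sg ?subr_gt0//; have [pq2|pq2|->] := ltgtP p.2 q.2.
  + by rewrite gtr0_sg ?subr_gt0// (H _ _ _ _ a1 (ltW pq1) b2 a3 (ltW pq2) b4)
      /rect_incr; ring.
  + by rewrite ltr0_sg ?subr_lt0// (H _ _ _ _ a1 (ltW pq1) b2 b3 (ltW pq2) a4)
      /rect_incr; ring.
  + by rewrite subrr sgr0 !(mul0r, mulr0) /rect_incr; ring.
- rewrite ltr0_sg ?subr_lt0//; have [pq2|pq2|->] := ltgtP p.2 q.2.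
  + by rewrite gtr0_sg ?subr_gt0// (H _ _ _ _ b1 (ltW pq1) a2 a3 (ltW pq2) b4)
      /rect_incr; ring.
  + by rewrite ltr0_sg ?subr_lt0// (H _ _ _ _ b1 (ltW pq1) a2 b3 (ltW pq2) a4)
      /rect_incr; ring.
  + by rewrite subrr sgr0 !(mul0r, mulr0) /rect_incr; ring.
- by rewrite subrr sgr0 !mul0r /rect_incr; ring.
Qed.

End Additivity.

(** * Continuity in the corners *)

Section Continuity.
Context {R : realType}.
Implicit Types (e : young_exponents R) (c : holder_consts R) (x y : R * R -> R).

(** [rect_integral_bound] with a constant that is uniform over the
    subrectangles; the value of [y] at a corner is compared with its value at
    [(s0, t0)] by the Hoelder bounds in each variable. *)
Lemma rect_integral_modulus e c s0 s1 t0 t1 x y :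
  young_pair e c s0 s1 t0 t1 x y -> exists2 B, 0 <= B &
  forall s s' t t', s0 <= s -> s <= s' -> s' <= s1 ->
    t0 <= t -> t <= t' -> t' <= t1 ->
  `|rect_integral y x s s' t t'| <=
     B * ((s' - s) `^ exp_gamma e * (t' - t) `^ exp_gamma' e).
Proof.
move=> Hp; pose C := young_const (exp_theta e).
have C0 : 0 <= C by apply: young_const_ge0; exact: exp_theta_gt1.
pose S := s1 - s0; pose T := t1 - t0.
pose N := `|y (s0, t0)| + const_s c * S `^ exp_alpha e +
  const_t c * T `^ exp_beta e.
pose B := const_x c * (N + C * (const_s c * S `^ exp_alpha e)
  + C * (const_t c * T `^ exp_beta e)
  + 2 * C ^+ 2 * (const_y c * (S `^ exp_rho e * T `^ exp_rho' e))).
have p0 := @powR_ge0 R.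
have K0 : 0 <= const_s c * S `^ exp_alpha e by rewrite mulr_ge0 ?const_s_ge0.
have K'0 : 0 <= const_t c * T `^ exp_beta e by rewrite mulr_ge0 ?const_t_ge0.
have Y0 : 0 <= const_y c * (S `^ exp_rho e * T `^ exp_rho' e).
  by rewrite !mulr_ge0 ?const_y_ge0.
exists B.
  apply: mulr_ge0; first exact: const_x_ge0.
  have N0 : 0 <= N by rewrite /N -addrA !addr_ge0.
  by rewrite !addr_ge0//; apply: mulr_ge0 => //; rewrite mulr_ge0 ?exprn_ge0.
move=> s s' t t' h1 h2 h3 h4 h5 h6.
have Hp' := young_pair_sub h1 h3 h4 h6 Hp.
apply: (le_trans (rect_integral_bound Hp' h2 h5)).
rewrite mulrAC /B ler_wpM2r ?mulr_ge0// ler_wpM2l ?const_x_ge0//.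
have ss1 := le_trans h2 h3; have tt1 := le_trans h5 h6.
have s01 := le_trans h1 ss1; have t01 := le_trans h4 tt1.
have dS : s' - s <= S by rewrite lerB.
have dT : t' - t <= T by rewrite lerB.
have dS0 : 0 <= s' - s by rewrite subr_ge0.
have dT0 : 0 <= t' - t by rewrite subr_ge0.
have [_ _ H1 H2] := Hp.
rewrite !lerD//.
- rewrite /N -addrA [y (s, t)](_ : _ = y (s0, t0) - ((y (s0, t0) - y (s, t0))
    + (y (s, t0) - y (s, t)))); last by ring.
  rewrite (le_trans (ler_normB _ _))// lerD//.
  rewrite (le_trans (ler_normD _ _))// lerD//.
    apply: (le_trans (H1 s0 s t0 _ _ _ _ _)) => //.
    rewrite ler_wpM2l ?const_s_ge0//.
    by rewrite powR_le ?subr_ge0 ?exp_alpha_ge0 ?lerD2r.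
  apply: (le_trans (H2 t0 t s _ _ _ _ _)) => //.
  by rewrite ler_wpM2l ?const_t_ge0// powR_le ?subr_ge0 ?exp_beta_ge0 ?lerD2r.
- by rewrite ler_wpM2l// ler_wpM2l ?const_s_ge0// powR_le ?exp_alpha_ge0.
- by rewrite ler_wpM2l// ler_wpM2l ?const_t_ge0// powR_le ?exp_beta_ge0.
- rewrite -/C; apply: ler_wpM2l; first by rewrite mulr_ge0 ?exprn_ge0.
  apply: ler_wpM2l; first exact: const_y_ge0.
  by rewrite ler_pM ?powR_le ?exp_rho_ge0 ?exp_rho'_ge0.
Qed.

(** A difference of [area] in one variable is an integral over a thin
    rectangle, because [area] vanishes on the two sides through
    [(s0, t0)]. *)
Lemma area_modulus e c s0 s1 t0 t1 x y :
  young_pair e c s0 s1 t0 t1 x y -> exists2 M, 0 <= M &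
  forall p q, rect s0 s1 t0 t1 p -> rect s0 s1 t0 t1 q ->
  `|area y x s0 t0 p - area y x s0 t0 q| <=
     M * (`|p.1 - q.1| `^ exp_gamma e + `|p.2 - q.2| `^ exp_gamma' e).
Proof.
move=> Hp; have [B B0 HB] := rect_integral_modulus Hp.
have HI := rect_integral_area Hp.
set F := area y x s0 t0 in HI *.
pose S := s1 - s0; pose T := t1 - t0.
have p0 := @powR_ge0 R.
have Fs a : s0 <= a -> a <= s1 -> t0 <= t1 -> F (a, t0) = 0.
  move=> ha ha' t01.
  have := HI s0 a t0 t0 (lexx _) ha ha' (lexx _) (lexx _) t01.
  by rewrite /F /area /= => ->; rewrite /rect_incr; ring.
have Ft b : t0 <= b -> b <= t1 -> s0 <= s1 -> F (s0, b) = 0.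
  move=> ha ha' t01.
  have := HI s0 s0 t0 b (lexx _) (lexx _) t01 (lexx _) ha ha'.
  by rewrite /F /area /= => ->; rewrite /rect_incr; ring.
have D1 a a' b : s0 <= a -> a <= a' -> a' <= s1 -> t0 <= b -> b <= t1 ->
    `|F (a, b) - F (a', b)| <= B * T `^ exp_gamma' e * `|a - a'| `^ exp_gamma e.
  move=> h1 h2 h3 h4 h5.
  have := HB a a' t0 b h1 h2 h3 (lexx _) h4 h5.
  rewrite HI// /rect_incr (Fs a) ?(le_trans h2)// ?(le_trans h4)//.
  rewrite (Fs a') ?(le_trans h1)// ?(le_trans h4)//.
  rewrite (_ : 0 - _ - 0 + _ = - (F (a, b) - F (a', b))); last by ring.
  rewrite normrN => /le_trans; apply; rewrite (distrC a) ger0_norm ?subr_ge0//.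
  rewrite -mulrA ler_wpM2l// mulrC ler_wpM2r//.
  by rewrite powR_le ?exp_gamma'_ge0 ?subr_ge0 ?lerD2r.
have D2 a b b' : s0 <= a -> a <= s1 -> t0 <= b -> b <= b' -> b' <= t1 ->
    `|F (a, b) - F (a, b')| <= B * S `^ exp_gamma e * `|b - b'| `^ exp_gamma' e.
  move=> h4 h5 h1 h2 h3.
  have := HB s0 a b b' (lexx _) h4 h5 h1 h2 h3.
  rewrite HI// /rect_incr (Ft b) ?(le_trans h2)// ?(le_trans h4)//.
  rewrite (Ft b') ?(le_trans h1)// ?(le_trans h4)//.
  rewrite (_ : 0 - _ - _ + _ = - (F (a, b) - F (a, b'))); last by ring.
  rewrite normrN => /le_trans; apply; rewrite (distrC b) ger0_norm ?subr_ge0//.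
  rewrite -mulrA ler_wpM2l// ler_wpM2r//.
  by rewrite powR_le ?exp_gamma_ge0 ?subr_ge0 ?lerD2r.
exists (B * T `^ exp_gamma' e + B * S `^ exp_gamma e).
  by rewrite addr_ge0 ?mulr_ge0.
move=> [a b] [a' b'] [/=]; rewrite !in_itv /= => /andP[a1 a2] /andP[b1 b2] [/=].
rewrite !in_itv /= => /andP[a3 a4] /andP[b3 b4].
apply: (le_trans (ler_distD (F (a', b)) _ _)).
rewrite mulrDr lerD//.
  apply: (@le_trans _ _ (B * T `^ exp_gamma' e * `|a - a'| `^ exp_gamma e)).
    have [aa'|/ltW a'a] := leP a a'; first exact: D1.
    by rewrite distrC [X in X `^ exp_gamma e]distrC D1.
  by rewrite ler_wpM2r// lerDl mulr_ge0.
apply: (@le_trans _ _ (B * S `^ exp_gamma e * `|b - b'| `^ exp_gamma' e)).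
  have [bb'|/ltW b'b] := leP b b'; first exact: D2.
  by rewrite distrC [X in X `^ exp_gamma' e]distrC D2.
by rewrite ler_wpM2r// lerDr mulr_ge0.
Qed.

Lemma powR_dist_cvg0 (T : Type) (G : set_system T) (FG : Filter G)
    (f : T -> R) (l p : R) : 0 < p ->
  f @ G --> l -> `|l - f z| `^ p @[z --> G] --> (0 : R).
Proof.
move=> p0 /cvgrPdist_le fl; apply/cvgrPdist_le => eps eps0.
have := fl (eps `^ p^-1) (powR_gt0 _ eps0); apply: filterS => z Hz.
rewrite sub0r normrN ger0_norm ?powR_ge0//.
rewrite (_ : eps = (eps `^ p^-1) `^ p); last first.
  by rewrite -powRrM mulVf ?gt_eqF// powRr1// ltW.
by rewrite powR_le// ltW.
Qed.

Lemma area_cvg e c s0 s1 t0 t1 x y (T : Type) (G : set_system T)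
    (FG : Filter G) (a b : T -> R) (a0 b0 : R) :
  young_pair e c s0 s1 t0 t1 x y -> 0 < exp_gamma e -> 0 < exp_gamma' e ->
  rect s0 s1 t0 t1 (a0, b0) ->
  (\forall z \near G, rect s0 s1 t0 t1 (a z, b z)) ->
  a @ G --> a0 -> b @ G --> b0 ->
  area y x s0 t0 (a z, b z) @[z --> G] --> area y x s0 t0 (a0, b0).
Proof.
move=> /area_modulus[M M0 HM] g0 g0' in0 inz acvg bcvg.
have w0 : M * (`|a0 - a z| `^ exp_gamma e + `|b0 - b z| `^ exp_gamma' e)
    @[z --> G] --> (0 : R).
  rewrite -[X in _ --> X](mulr0 M); apply: cvgM; first exact: cvg_cst.
  by rewrite -[X in _ --> X]addr0; apply: cvgD; exact: powR_dist_cvg0.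
move/cvgrPdist_le : w0 => w0; apply/cvgrPdist_le => eps /w0; apply: filterS2 inz.
move=> z inz; rewrite sub0r normrN => /(le_trans (ler_norm _)).
exact: le_trans (HM _ _ in0 inz).
Qed.

Lemma oriented_integral_continuous e c s0 s1 t0 t1 x y :
  young_pair e c s0 s1 t0 t1 x y -> 0 < exp_gamma e -> 0 < exp_gamma' e ->
  {within rect s0 s1 t0 t1 `*` rect s0 s1 t0 t1,
     continuous (fun pq => oriented_integral y x pq.1 pq.2)}.
Proof.
move=> Hp g0 g0'; set D := rect s0 s1 t0 t1.
apply/subspace_continuousP => -[[a b] [a' b']] [/= Dp Dq].
set G := within _ _.
have FG : Filter G by exact: within_filter.
have inD : \forall z \near G, D z.1 /\ D z.2 by exact: withinT.
have cv (f : (R * R) * (R * R) -> R) z : {for z, continuous f} ->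
    f @ within (D `*` D) (nbhs z) --> f z.
  by move=> fz; apply: cvg_within_filter.
have c11 : z.1.1 @[z --> G] --> a.
  apply: (cv (fun z => z.1.1)); apply: (@continuous_comp _ _ _ fst fst);
    exact: cvg_fst.
have c12 : z.1.2 @[z --> G] --> b.
  apply: (cv (fun z => z.1.2)); apply: (@continuous_comp _ _ _ fst snd);
    [exact: cvg_fst|exact: cvg_snd].
have c21 : z.2.1 @[z --> G] --> a'.
  apply: (cv (fun z => z.2.1)); apply: (@continuous_comp _ _ _ snd fst);
    [exact: cvg_snd|exact: cvg_fst].
have c22 : z.2.2 @[z --> G] --> b'.
  apply: (cv (fun z => z.2.2)); apply: (@continuous_comp _ _ _ snd snd);
    exact: cvg_snd.
change (oriented_integral y x z.1 z.2 @[z --> G] -->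
  oriented_integral y x (a, b) (a', b')).
rewrite (oriented_integral_area Hp Dp Dq) /=.
have inc : rect_incr (area y x s0 t0) z.1.1 z.2.1 z.1.2 z.2.2 @[z --> G] -->
    rect_incr (area y x s0 t0) a a' b b'.
  case: Dp => [/= Da Db]; case: Dq => [/= Da' Db'].
  apply: cvgD; first apply: cvgB; first apply: cvgB;
    by apply: (area_cvg FG Hp) => //;
      apply: filterS inD => z [[/= ? ?] [/= ? ?]].
apply: cvg_trans inc; apply: near_eq_cvg; apply: filterS inD => z [D1 D2].
by rewrite (oriented_integral_area Hp D1 D2).
Qed.

End Continuity.

(** * The integral of Hoelder functions on a rectangle *)

Theorem proposition2p3 (R : realType) (R1 R2 : R)
    (gamma gamma' rho rho' alpha beta : R)
    (hR : R1 < R2)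
    (hgamma : 0 < gamma < 1) (hgamma' : 0 < gamma' < 1)
    (hrho : 0 < rho < 1) (hrho' : 0 < rho' < 1)
    (hgr : gamma + rho > 1) (hgr' : gamma' + rho' > 1)
    (halpha : alpha > 1 - gamma) (hbeta : beta > 1 - gamma') :
  let Rbar := rect R1 R2 R1 R2 in
  exists2 C : R, 0 < C &
  forall x y : R * R -> R,
    rect_holder Rbar gamma gamma' x ->
    rect_holder Rbar rho rho' y ->
    (forall s1 s2 t1 t2 : R,
       s1 < s2 -> t1 < t2 -> rect s1 s2 t1 t2 `<=` Rbar ->
       holder_cond s1 s2 t1 t2 alpha beta y ->
       riemann_sums_cvg y x s1 s2 t1 t2 (rect_integral y x s1 s2 t1 t2) /\
       (`|rect_integral y x s1 s2 t1 t2|%:E <=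
          C%:E * (sup_norm Rbar y +
                  (rect_norm Rbar rho rho' y +
                   holder_norm1 (rect s1 s2 t1 t2) alpha y +
                   holder_norm2 (rect s1 s2 t1 t2) beta y)) *
          rect_norm Rbar gamma gamma' x *
          ((s2 - s1) `^ gamma * (t2 - t1) `^ gamma')%:E)%E) /\
    (holder_cond R1 R2 R1 R2 alpha beta y ->
       {within Rbar `*` Rbar,
         continuous (fun pq => oriented_integral y x pq.1 pq.2)}).
Proof.
move=> Rbar.
pose theta := Num.min (Num.min (alpha + gamma) (rho + gamma))
                      (Num.min (beta + gamma') (rho' + gamma')).
have [/andP[g0 g1] /andP[g0' g1']] := (hgamma, hgamma').
have [/andP[r0 r1] /andP[r0' r1']] := (hrho, hrho').
have a0 : 0 < alpha by lra.
have b0 : 0 < beta by lra.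
have th1 : 1 < theta.
  by rewrite !lt_min; apply/andP; split; apply/andP; split; lra.
have th_a : theta <= alpha + gamma by rewrite !ge_min lexx.
have th_r : theta <= rho + gamma by rewrite !ge_min lexx orbT.
have th_b : theta <= beta + gamma' by rewrite !ge_min lexx !orbT.
have th_r' : theta <= rho' + gamma' by rewrite !ge_min lexx !orbT.
pose e := YoungExponents th1
  (ltW g0) (ltW g0') (ltW r0) (ltW r0') (ltW a0) (ltW b0) th_a th_r th_b th_r'.
pose c := young_const theta; have c0 : 0 <= c by exact: young_const_ge0.
pose L := R2 - R1.
have p0 := @powR_ge0 R.
pose Cr := 2 * c ^+ 2 * (L `^ rho * L `^ rho').
have Cr0 : 0 <= Cr by apply: mulr_ge0; apply: mulr_ge0 => //; exact: exprn_ge0.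
have ca0 : 0 <= c * L `^ alpha by rewrite mulr_ge0.
have cb0 : 0 <= c * L `^ beta by rewrite mulr_ge0.
(* The coefficients of rect_integral_bound, all lengths being at most L. *)
exists (1 + c * L `^ alpha + c * L `^ beta + Cr).
  by rewrite -!addrA ltr_pwDl// !addr_ge0.
move=> x y [_ xfin] [_ yfin].
have [X [EX X0 HX]] := rect_norm_bound hR hR xfin.
have [Y [EY Y0 HY]] := rect_norm_bound hR hR yfin.
split; last first.
  move=> /holder_cond_bounds[K [K' [K0 K'0 H1 H2]]].
  by apply: (@oriented_integral_continuous _ e (HolderConsts X0 Y0 K0 K'0)).
move=> s1 s2 t1 t2 s12 t12 sub /holder_cond_bounds[K [K' [_ _ H1 H2]]].
have [s_1 s_2 t_1 t_2] := (rect_subset _ _ _ _ (ltW s12) (ltW t12)).1 sub.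
have [h1 [E1 h10 {}H1]] := holder_norm1_bound s12 (ltW t12) H1.
have [h2 [E2 h20 {}H2]] := holder_norm1_bound t12 (ltW s12) H2.
rewrite holder_norm2_transpose EX EY E1 E2.
pose k := HolderConsts X0 Y0 h10 h20.
have Hp : young_pair e k s1 s2 t1 t2 x y.
  have w M a b f :
      rect_bound R1 R2 R1 R2 M a b f -> rect_bound s1 s2 t1 t2 M a b f.
    move=> Hf s s' t t' i1 i2 i3 i4 i5 i6; apply: Hf => //.
    - exact: le_trans i1.
    - exact: le_trans s_2.
    - exact: le_trans i4.
    - exact: le_trans t_2.
  by split => //; apply: w.
split; first exact: (rect_integralP Hp (ltW s12) (ltW t12)).
have := rect_integral_bound Hp (ltW s12) (ltW t12); rewrite /= -/c.
set I := rect_integral _ _ _ _ _ _; set Z := (s2 - s1) `^ gamma * _.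
have Z0 : 0 <= Z by rewrite mulr_ge0.
have dS : s2 - s1 <= L by rewrite lerB.
have dT : t2 - t1 <= L by rewrite lerB.
have dS0 : 0 <= s2 - s1 by rewrite subr_ge0 ltW.
have dT0 : 0 <= t2 - t1 by rewrite subr_ge0 ltW.
have ysup : (`|y (s1, t1)|%:E <= sup_norm Rbar y)%E.
  apply: ereal_sup_ubound; exists (s1, t1) => //; apply: sub.
  by rewrite /rect /= !in_itv /= !lexx !ltW.
(* Replacing |y (s1, t1)| by the supremum leaves an inequality between real
   numbers. *)
move=> HI; apply: (@le_trans _ _ ((1 + c * L `^ alpha + c * L `^ beta + Cr)%:E *
    (`|y (s1, t1)|%:E + (Y%:E + h1%:E + h2%:E)) * X%:E * Z%:E)%E); last first.
  rewrite lee_wpmul2r ?lee_fin// lee_wpmul2r ?lee_fin// lee_wpmul2l//.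
    by rewrite lee_fin -!addrA !addr_ge0.
  by rewrite leeD2r.
rewrite -!EFinD -!EFinM lee_fin; apply: (le_trans HI).
rewrite [leRHS](_ : _ = X * Z * ((1 + c * L `^ alpha + c * L `^ beta + Cr) *
    (`|y (s1, t1)| + (Y + h1 + h2)))); last by ring.
rewrite ler_wpM2l ?mulr_ge0//.
have la : c * (h1 * (s2 - s1) `^ alpha) <= c * L `^ alpha * h1.
  by rewrite mulrCA mulrC ler_wpM2r// ler_wpM2l// powR_le// ltW.
have lb : c * (h2 * (t2 - t1) `^ beta) <= c * L `^ beta * h2.
  by rewrite mulrCA mulrC ler_wpM2r// ler_wpM2l// powR_le// ltW.
have lr : 2 * c ^+ 2 * (Y * ((s2 - s1) `^ rho * (t2 - t1) `^ rho')) <= Cr * Y.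
  rewrite mulrCA mulrC ler_wpM2r//; apply: ler_wpM2l.
    by rewrite mulr_ge0 ?exprn_ge0.
  by apply: ler_pM => //; apply: powR_le => //; exact: ltW.
have n0 := normr_ge0 (y (s1, t1)).
set A := c * L `^ alpha in ca0 la *; set B := c * L `^ beta in cb0 lb *.
set N := `|y (s1, t1)| in n0 *.
have := mulr_ge0 ca0 (addr_ge0 n0 (addr_ge0 Y0 h20)).
have := mulr_ge0 cb0 (addr_ge0 n0 (addr_ge0 Y0 h10)).
have := mulr_ge0 Cr0 (addr_ge0 n0 (addr_ge0 h10 h20)).
lra.
Qed.
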